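(* Let $r\in \mathbb{N}$ with $r\geq 3$, and let $K\subseteq \{1,\ldots,r-2\}$ be nonempty. Then the structures $(\mathbb{R},<,+,C_{r,K})$ and $\mathcal S_r=(\mathbb{R},<,+,W_r)$ are interdefinable, i.e. they define exactly the same subsets of $\mathbb{R}^n$ (with parameters), for every $n$.
   Context: Let $\Sigma_r=\{0,\ldots,r-1\}$. A base $r$ expansion of $x\in\mathbb{R}$ is a word $a_p\cdots a_0\star a_{-1}a_{-2}\cdots$ with $a_p\in\{0,r-1\}$, $a_{p-1},a_{p-2},\ldots\in\Sigma_r$, such that $x=-a_pr^p+\sum_{i=-\infty}^{p-1}a_ir^i$; $a_k$ is the digit in the position corresponding to $r^k$. $V_r(x,u,k)$ is the ternary predicate holding iff some base $r$ expansion of $x$ has $u=r^n$ for some $n\in\mathbb{Z}$ and $a_n=k$. $W_r$ is the intersection of $V_r$ with $[0,1]\times r^{-\mathbb{N}}\times\Sigma_r$ (here $\mathbb{N}$ contains $0$). For nonempty $K\subseteq\{1,\ldots,r-2\}$, $C_{r,K}$ is the set of numbers in $[0,1]$ admitting a base $r$ expansion omitting the digits in $K$. Two expansions of $(\mathbb{R},<)$ are interdefinable if they define the same sets, with parameters. *)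

(* Defs.v *)
From HB Require Import structures.
From mathcomp Require Import all_boot all_order all_algebra.
From mathcomp Require Import all_classical all_reals all_analysis.

Set Implicit Arguments.
Unset Strict Implicit.
Unset Printing Implicit Defensive.

Import Order.TTheory GRing.Theory Num.Theory.
Import numFieldNormedType.Exports.

Local Open Scope classical_set_scope.
Local Open Scope ring_scope.

(* Points of [T^n] are encoded as row vectors ['rV[T]_n]. *)

Record language := Language {
  fsym : Type;
  farity : fsym -> nat;
  rsym : Type;
  rarity : rsym -> nat
}.

Record structure (L : language) (T : Type) := Structure {
  finterp : forall f : fsym L, 'rV[T]_(farity f) -> T;
  rinterp : forall s : rsym L, set 'rV[T]_(rarity s)
}.

Inductive term (L : language) (n : nat) : Type :=
| Var of 'I_n
| App (f : fsym L) of ('I_(farity f) -> term L n).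

(* [formula L n]: the [L]-formulas with free variables among
   [Var 0, ..., Var (n - 1)]. [Ex] binds variable [0] of its body, the other
   variables being shifted by one (de Bruijn indices). *)
Inductive formula (L : language) : nat -> Type :=
| Equal n of term L n & term L n : formula L n
| Rel n (s : rsym L) of ('I_(rarity s) -> term L n) : formula L n
| Not n of formula L n : formula L n
| And n of formula L n & formula L n : formula L n
| Ex n of formula L (1 + n) : formula L n.

Section semantics.
Variables (L : language) (T : Type) (M : structure L T).

Fixpoint eval_term n (v : 'rV[T]_n) (t : term L n) : T :=
  match t with
  | Var i => v ord0 i
  | App f ts => finterp M (\row_i eval_term v (ts i))
  end.

Fixpoint sat n (phi : formula L n) : 'rV[T]_n -> Prop :=
  match phi in formula _ n return 'rV[T]_n -> Prop with
  | Equal _ t u => fun v => eval_term v t = eval_term v u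
  | Rel _ s ts => fun v => rinterp M (\row_i eval_term v (ts i))
  | Not _ psi => fun v => ~ sat psi v
  | And _ psi chi => fun v => sat psi v /\ sat chi v
  | Ex _ psi => fun v => exists x : T, sat psi (row_mx (const_mx x : 'rV_1) v)
  end.

(* [b] is the tuple of parameters. *)
Definition definable n (A : set 'rV[T]_n) : Prop :=
  exists (m : nat) (phi : formula L (n + m)) (b : 'rV[T]_m),
    A = [set a | sat phi (row_mx a b)].

End semantics.

Definition interdefinable (L1 L2 : language) (T : Type)
    (M1 : structure L1 T) (M2 : structure L2 T) : Prop :=
  forall (n : nat) (A : set 'rV[T]_n), definable M1 A <-> definable M2 A.

Variant exp_fsym := Plus.
Variant exp_rsym := Less | Pred.

Definition exp_language (m : nat) : language :=
  {| fsym := exp_fsym;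
     farity := fun=> 2%N;
     rsym := exp_rsym;
     rarity := fun s => match s with Less => 2%N | Pred => m end |}.

Definition expansion_by (R : realType) (m : nat) (P : set 'rV[R]_m) :
    structure (exp_language m) R :=
  @Structure (exp_language m) R
    (fun _ (v : 'rV[R]_2) => v 0 0 + v 0 1)
    (fun s : exp_rsym =>
       match s return set 'rV[R]_(@rarity (exp_language m) s) with
       | Less => [set v : 'rV[R]_2 | v 0 0 < v 0 1]
       | Pred => P
       end).

Section base_r.
Variables (R : realType) (r : nat).

(* [a i] is the digit in the position of [r ^ i]; the word
   [a_p ... a_0 * a_{-1} a_{-2} ...] consists of the [a i] with [i <= p], the
   values of [a] above [p] are irrelevant. The [k]-th term of the series is
   that of position [p - 1 - k]. *)
Definition is_expansion (p : nat) (a : int -> nat) (x : R) : Prop :=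
  [/\ a p = 0%N \/ a p = (r - 1)%N,
      forall i : int, i < p%:Z -> (a i < r)%N
    & - ((a p)%:R * r%:R ^+ p) +
        \sum_(0 <= k < N) (a (p%:Z - 1 - k%:Z))%:R * r%:R ^ (p%:Z - 1 - k%:Z)
      @[N --> \oo] --> x].

Definition V_pred (x u k : R) : Prop :=
  exists (p : nat) (a : int -> nat) (n : int),
    [/\ is_expansion p a x, n <= p%:Z, u = r%:R ^ n & (a n)%:R = k].

Definition W_pred (x u k : R) : Prop :=
  [/\ V_pred x u k, 0 <= x <= 1, exists n : nat, u = r%:R ^- n
    & exists2 d : nat, (d < r)%N & k = d%:R].

Definition W_set : set 'rV[R]_3 := [set v | W_pred (v 0 0) (v 0 1) (v 0 2)].

Definition C_pred (K : set nat) : set R :=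
  [set x | 0 <= x <= 1 /\
    exists (p : nat) (a : int -> nat),
      is_expansion p a x /\ forall i : int, i <= p%:Z -> ~ K (a i)].

Definition C_set (K : set nat) : set 'rV[R]_1 :=
  [set v | C_pred K (v 0 0)].

End base_r.

Definition S_structure (R : realType) (r : nat) : structure (exp_language 3) R :=
  expansion_by (@W_set R r).

(* Main.v *)
Require Import Defs.
From mathcomp Require Import all_boot all_order all_algebra.
From mathcomp Require Import all_classical all_reals all_analysis.
From mathcomp Require Import ring lra zify.

(* From W_r to C: membership in C can be tested position by position, because
   peeling off an admissible digit preserves the condition that, at every
   position, some expansion of x has a digit outside K.

   From C to W_r: let k be the least element of K, c the least digit outside K
   above k, and xi the number whose base r digits are all equal to c. Going left
   from xi, the gaps of C longer than all the gaps between them and xi are those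
   ending at the truncations of xi, whose distances to xi are xi * r^-n; this
   defines r^-N. The right ends of the gaps of length at least u = r^-n are
   multiples of u, and include all numbers with n digits in {0, c}. The sums of
   r - 1 of them contain every multiple of c * u in [0, c[, so adding t * u for
   t < c yields the multiples of u, uniformly in u, and digits are read off from
   these grids. No parameters are needed. *)

Set Implicit Arguments.
Unset Strict Implicit.
Unset Printing Implicit Defensive.

Import Order.TTheory GRing.Theory Num.Theory.
Import numFieldNormedType.Exports.

Local Open Scope classical_set_scope.
Local Open Scope ring_scope.

(** * Closure properties of parameter-free definability *)

Section env_definability.
Variables (R : realType) (m : nat) (P : set 'rV[R]_m).
Implicit Types (A B : (nat -> R) -> Prop) (f g h : (nat -> R) -> R).

Definition scons (x : R) (e : nat -> R) (i : nat) : R :=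
  if i is j.+1 then e j else x.

(* Parameter-free definability; variables are indexed by [nat], so that arities
   and weakening need not be tracked. *)
Inductive envdef : ((nat -> R) -> Prop) -> Prop :=
| envdef_ltv i j : envdef (fun e => e i < e j)
| envdef_addv i j k : envdef (fun e => e i + e j = e k)
| envdef_predv (s : 'I_m -> nat) : envdef (fun e => P (\row_i e (s i)))
| envdef_not A : envdef A -> envdef (fun e => ~ A e)
| envdef_and A B : envdef A -> envdef B -> envdef (fun e => A e /\ B e)
| envdef_scons A : envdef A -> envdef (fun e => exists x, A (scons x e))
| envdef_ext A B : envdef A -> (forall e, A e <-> B e) -> envdef B.

(** The map [s] names each of the infinitely many indices by one of the [n] variables at hand. Both
    [n] and [s] are universally quantified because passing under [Ex] changes both. *)
Lemma envdef_formula A : envdef A -> forall n (s : nat -> 'I_n),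
  exists phi : formula (exp_language m) n,
    forall v, sat (expansion_by P) phi v <-> A (fun i => v 0 (s i)).
Proof.
elim=> {A} [i j|i j k|t|A _ IH|A B _ IHA _ IHB|A _ IH|A B _ IH AB] n s.
- exists (@Rel (exp_language m) n Less
    (fun a : 'I_2 => Var _ (if a == 0 then s i else s j))).
  by move=> v /=; rewrite !mxE.
- exists (@Equal (exp_language m) n
    (@App (exp_language m) n Plus
      (fun a : 'I_2 => Var _ (if a == 0 then s i else s j)))
    (Var _ (s k))).
  by move=> v /=; rewrite !mxE.
- exists (@Rel (exp_language m) n Pred (fun a : 'I_m => Var _ (s (t a)))).
  by move=> v /=.
- have [phi phiE] := IH n s.
  by exists (Not phi) => v /=; rewrite phiE.
- have [phi phiE] := IHA n s; have [psi psiE] := IHB n s.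
  by exists (And phi psi) => v /=; rewrite phiE psiE.
- pose s' i : 'I_(1 + n) := if i is j.+1 then rshift 1 (s j) else lshift n ord0.
  have [phi phiE] := IH _ s'.
  exists (Ex phi) => v /=.
  have E x : (fun i => (row_mx (const_mx x : 'rV_1) v) 0 (s' i)) =
      scons x (fun i => v 0 (s i)).
    apply/funext => -[|i] /=; first by rewrite row_mxEl mxE.
    by rewrite row_mxEr.
  by split=> -[x Hx]; exists x; [rewrite -E -phiE|rewrite phiE E].
- have [phi phiE] := IH n s.
  by exists phi => v; rewrite phiE AB.
Qed.

Lemma envdef_rename A : envdef A ->
  forall s : nat -> nat, envdef (fun e => A (fun i => e (s i))).
Proof.
elim=> {A} [i j|i j k|t|A _ IH|A B _ IHA _ IHB|A _ IH|A B _ IH AB] s.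
- exact: envdef_ltv.
- exact: envdef_addv.
- exact: (envdef_predv (fun i => s (t i))).
- exact: envdef_not.
- exact: envdef_and.
- pose s' i := if i is j.+1 then (s j).+1 else 0%N.
  apply: envdef_ext (envdef_scons (IH s')) _ => e.
  have E x : (fun i => scons x e (s' i)) = scons x (fun i => e (s i)).
    by apply/funext => -[|i].
  by split=> -[x Hx]; exists x; move: Hx; rewrite E.
- by apply: envdef_ext (IH s) _ => e; exact: AB.
Qed.

Lemma envdef_ex (A : R -> (nat -> R) -> Prop) :
  envdef (fun e => A (e 0%N) (fun i => e i.+1)) ->
  envdef (fun e => exists x, A x e).
Proof. exact: envdef_scons. Qed.

Lemma envdef_or A B : envdef A -> envdef B -> envdef (fun e => A e \/ B e).
Proof.
move=> dA dB.
apply: envdef_ext (envdef_not (envdef_and (envdef_not dA) (envdef_not dB))) _.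
move=> e; split=> [H|[a|b] []//].
by have [a|nA] := pselect (A e); [left|right; apply: contrapT => nB; apply: H].
Qed.

Lemma envdef_imp A B : envdef A -> envdef B -> envdef (fun e => A e -> B e).
Proof.
move=> dA dB; apply: envdef_ext (envdef_or (envdef_not dA) dB) _ => e.
split=> [[]//|AB].
by have [a|nA] := pselect (A e); [right; exact: AB|left].
Qed.

Lemma envdef_all (A : R -> (nat -> R) -> Prop) :
  envdef (fun e => A (e 0%N) (fun i => e i.+1)) ->
  envdef (fun e => forall x, A x e).
Proof.
move=> dA; have dN := envdef_not (envdef_ex (A := fun x e => ~ A x e)
  (envdef_not dA)).
apply: envdef_ext dN _ => e; split=> [H x|H [x]//].
by apply: contrapT => nA; apply: H; exists x.
Qed.

(** By excluded middle [Q] is equivalent to a fixed true or false formula, so an arbitrary set of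
    digits can be used without being computable. *)
Lemma envdef_cst (Q : Prop) : envdef (fun=> Q).
Proof.
have dF : envdef (fun e : nat -> R => e 0%N < e 0%N) := envdef_ltv 0 0.
have [q|nq] := pselect Q.
  by apply: envdef_ext (envdef_not dF) _ => e; rewrite ltxx; split.
by apply: envdef_ext dF _ => e; rewrite ltxx; split.
Qed.

(** The bounded variable is a numeral and not an element of the structure: the formula is a finite
    disjunction. *)
Lemma envdef_ex_ltn N (A : nat -> (nat -> R) -> Prop) :
  (forall d, envdef (A d)) -> envdef (fun e => exists2 d, (d < N)%N & A d e).
Proof.
move=> dA; elim: N => [|N IH].
  by apply: envdef_ext (envdef_cst False) _ => e; split=> // -[].
apply: envdef_ext (envdef_or IH (dA N)) _ => e; split=> [[[d dN Ad]|AN]|[d]].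
- by exists d => //; exact: leqW.
- by exists N.
- by rewrite ltnS leq_eqVlt => /predU1P[->|dN] Ad; [right|left; exists d].
Qed.

Definition envfun f := envdef (fun e => e 0%N = f (fun i => e i.+1)).

(** Substitution of a definable function for a variable: its value is named by an existential
    quantifier. *)
Lemma envdef_app f (A : R -> (nat -> R) -> Prop) : envfun f ->
  envdef (fun e => A (e 0%N) (fun i => e i.+1)) -> envdef (fun e => A (f e) e).
Proof.
move=> df dA; have := envdef_ex (A := fun x e => x = f e /\ A x e)
  (envdef_and df dA).
by move=> dE; apply: envdef_ext dE _ => e; split=> [[x [->]]//|?]; exists (f e).
Qed.

Lemma envfun_shift f : envfun f -> envfun (fun e => f (fun i => e i.+1)).
Proof.
by move=> df; exact: (envdef_rename df (fun i => if i is 0 then 0%N else i.+1)).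
Qed.

Lemma envdef_lt f g : envfun f -> envfun g -> envdef (fun e => f e < g e).
Proof.
move=> df dg; apply: (envdef_app (A := fun x e => x < g e) df).
apply: (envdef_app (A := fun y e => e 0%N < y) (envfun_shift dg)).
exact: envdef_ltv.
Qed.

Lemma envdef_le f g : envfun f -> envfun g -> envdef (fun e => f e <= g e).
Proof.
move=> df dg; apply: envdef_ext (envdef_not (envdef_lt dg df)) _ => e.
by rewrite leNgt; split => /negP.
Qed.

Lemma envdef_eq f g : envfun f -> envfun g -> envdef (fun e => f e = g e).
Proof.
move=> df dg.
apply: envdef_ext (envdef_and (envdef_le df dg) (envdef_le dg df)) _ => e.
by split=> [[a b]|->//]; apply/eqP; rewrite eq_le a b.
Qed.

(** Equality of two variables is not among the constructors of [envdef]; it is obtained as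
    incomparability in the order. *)
Lemma envfun_var i : envfun (fun e => e i).
Proof.
have dlt j k := envdef_not (envdef_ltv j k).
apply: envdef_ext (envdef_and (dlt 0%N i.+1) (dlt i.+1 0%N)) _ => e.
split=> [[/negP a /negP b]|->]; last by rewrite ltxx.
by apply/eqP; rewrite eq_le !leNgt a b.
Qed.

Lemma envfunD f g : envfun f -> envfun g -> envfun (fun e => f e + g e).
Proof.
move=> df dg.
apply: (envdef_app (A := fun x e => e 0%N = x + g (fun i => e i.+1))
  (envfun_shift df)).
apply: (envdef_app (A := fun y e => e 1%N = e 0%N + y)
  (envfun_shift (envfun_shift dg))).
by apply: envdef_ext (envdef_addv 1 0 2) _ => e; split=> ->.
Qed.

Lemma envfun0 : envfun (fun=> 0).
Proof.
apply: envdef_ext (envdef_addv 0 0 0) _ => e; split=> [E|->]; last exact: addr0.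
by apply: (addrI (e 0%N)); rewrite addr0.
Qed.

Lemma envfunMn n f : envfun f -> envfun (fun e => n%:R * f e).
Proof.
move=> df; elim: n => [|n IH].
  by apply: envdef_ext envfun0 _ => e; rewrite mul0r.
apply: envdef_ext (envfunD df IH) _ => e.
by rewrite -natr1 addrC mulrDl mul1r.
Qed.

Lemma envfunB f g : envfun f -> envfun g -> envfun (fun e => f e - g e).
Proof.
move=> df dg.
apply: envdef_ext (envdef_eq (envfunD (envfun_var 0) (envfun_shift dg))
  (envfun_shift df)) _ => e.
by split=> [<-|->]; rewrite ?addrK ?subrK.
Qed.

Lemma envfun_divn n f : (0 < n)%N -> envfun f -> envfun (fun e => f e / n%:R).
Proof.
move=> n0 df.
apply: envdef_ext (envdef_eq (envfunMn n (envfun_var 0)) (envfun_shift df)) _.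
have n0' : n%:R != 0 :> R by rewrite pnatr_eq0 -lt0n.
by move=> e; split=> [<-|->]; rewrite mulrC ?mulKf ?divfK.
Qed.

End env_definability.

(** * Translation of formulas along a definition of one predicate from another *)

Section translation.
Variables (R : realType) (m1 m2 : nat).
Variables (P1 : set 'rV[R]_m1) (P2 : set 'rV[R]_m2).
Hypothesis P1def : forall s : 'I_m1 -> (nat -> R) -> R,
  (forall i, envfun P2 (s i)) -> envdef P2 (fun e => P1 (\row_i s i e)).

Lemma envfun_term n (t : term (exp_language m1) n) (s : 'I_n -> nat) :
  envfun P2 (fun e => eval_term (expansion_by P1) (\row_i e (s i)) t).
Proof.
elim: t => [i|f ts IH] /=.
  by apply: envdef_ext (envfun_var P2 (s i)) _ => e; rewrite mxE.
by apply: envdef_ext (envfunD (IH 0) (IH 1)) _ => e; rewrite !mxE.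
Qed.

Lemma envdef_sat n (phi : formula (exp_language m1) n) (s : 'I_n -> nat) :
  envdef P2 (fun e => sat (expansion_by P1) phi (\row_i e (s i))).
Proof.
elim: phi s => {n} [n t u|n [] ts|n phi IH|n phi IHp psi IHq|n phi IH] s /=.
- by apply: envdef_eq; exact: envfun_term.
- apply: envdef_ext (envdef_lt (envfun_term (ts 0) s) (envfun_term (ts 1) s)) _.
  by move=> e; rewrite !mxE.
- by apply: P1def => i; exact: envfun_term.
- exact: envdef_not.
- exact: envdef_and.
(* The bound variable takes index 0 and the free ones move up by one, matching [scons]. *)
- pose s' (i : 'I_(1 + n)) :=
    if fintype.split i is inr j then (s j).+1 else 0%N.
  apply: envdef_ext (envdef_scons (IH s')) _ => e.
  have E x : \row_i scons x e (s' i) =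
      row_mx (const_mx x : 'rV_1) (\row_i e (s i)).
    apply/rowP => i; rewrite mxE /s' -[i in RHS]splitK.
    by case: (fintype.split i) => j; rewrite ?row_mxEl ?row_mxEr mxE.
  by split=> -[x Hx]; exists x; move: Hx; rewrite E.
Qed.

(** Only the formula is translated; the parameters [b] stay the same, since [P1] is defined from
    [P2] without parameters. *)
Lemma definable_expansion n (A : set 'rV[R]_n) :
  definable (expansion_by P1) A -> definable (expansion_by P2) A.
Proof.
move=> [k [phi [b ->]]].
(* The quantified variable only provides a value for the indices beyond
   [n + k], which may be zero. *)
pose s (i : nat) : 'I_(1 + (n + k)) :=
  if insub i is Some j then rshift 1 j else lshift _ ord0.
have [psi psiE] := envdef_formula (envdef_sat phi (fun i => i)) s.
exists k, (Ex psi), b; apply/seteqP; split=> a /=.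
all: have E x : (\row_i (row_mx (const_mx x : 'rV_1) (row_mx a b)) 0 (s i)) =
    row_mx a b.
all: try by apply/rowP => i; rewrite mxE /s valK row_mxEr.
- by move=> sa; exists 0; rewrite psiE E.
- by move=> [x]; rewrite psiE E.
Qed.

End translation.

(** * Base r expansions of numbers in the unit interval *)

Section base_r_expansions.
Variables (R : realType) (r : nat).
Hypothesis r_ge3 : (3 <= r)%N.

Let r_ge3R : 3 <= r%:R :> R. Proof. by rewrite (ler_nat _ 3). Qed.
Let r_gt0 : 0 < r%:R :> R. Proof. by move: r_ge3R; lra. Qed.
Let r_neq0 : r%:R != 0 :> R. Proof. by rewrite gt_eqF. Qed.

Let q (n : nat) : R := r%:R ^- n.

Let q0 : q 0 = 1. Proof. by rewrite /q expr0 invr1. Qed.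

Let qS n : r%:R * q n.+1 = q n.
Proof. by rewrite /q exprS invfM mulrA divff ?mul1r. Qed.

Let q_gt0 n : 0 < q n. Proof. by rewrite /q invr_gt0 exprn_gt0. Qed.

Let q_le1 n : q n <= 1.
Proof. by rewrite /q invf_le1 ?exprn_gt0// exprn_ege1//; move: r_ge3R; lra. Qed.

Let pow_qE n : r%:R ^+ n * q n = 1.
Proof. by rewrite divff// expf_neq0. Qed.

Definition psum (e : nat -> nat) (N : nat) : R :=
  \sum_(0 <= i < N) (e i)%:R * q i.+1.

(** Nested closed intervals take the place of a limit, which turns later arguments into
    inequalities; [digits_cvg] gives the equivalence. The closed right ends allow tails of digits
    [r - 1], and in particular an expansion of 1. *)
Definition digits (e : nat -> nat) (x : R) :=
  forall N, (e N < r)%N /\ psum e N <= x <= psum e N + q N.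

Lemma psum0 e : psum e 0 = 0. Proof. by rewrite /psum big_geq. Qed.

Lemma psumS e N : psum e N.+1 = psum e N + (e N)%:R * q N.+1.
Proof. by rewrite /psum big_nat_recr. Qed.

Lemma psum_cons j e N :
  r%:R * psum (fun i => if i is i'.+1 then e i' else j) N.+1 = j%:R + psum e N.
Proof.
rewrite /psum big_nat_recl// mulrDr mulrCA qS q0 mulr1; congr (_ + _).
by rewrite mulr_sumr; apply: eq_bigr => i _; rewrite mulrCA qS.
Qed.

Lemma psumS_nat e N M : psum e N = M%:R * q N ->
  psum e N.+1 = (r * M + e N)%:R * q N.+1.
Proof. by move=> ME; rewrite psumS ME -(qS N) natrD natrM; ring. Qed.

Lemma psum_nat e N : exists M : nat, psum e N = M%:R * q N.
Proof.
elim: N => [|N [M ME]]; first by exists 0%N; rewrite psum0 mul0r.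
by exists (r * M + e N)%N; exact: psumS_nat.
Qed.

Lemma cvg_q : q @ \oo --> 0.
Proof.
rewrite (_ : q = fun n => r%:R^-1 ^+ n); last first.
  by apply/funext => n; rewrite /q exprVn.
apply: cvg_expr; rewrite normfV invf_lt1 ?normr_gt0//.
by rewrite ger0_norm ?ltW//; move: r_ge3R; lra.
Qed.

Lemma digits_cvg e x : (forall N, (e N < r)%N) ->
  psum e @ \oo --> x <-> digits e x.
Proof.
move=> er; split=> [cvx N|dx].
  split=> //.
  (* The intervals [[psum e N, psum e N + q N]] are nested because each digit is at most [r - 1]. *)
  have le_psum M : psum e N <= psum e (N + M) /\
      psum e (N + M) + q (N + M) <= psum e N + q N.
    elim: M => [|M [IH1 IH2]]; first by rewrite addn0.
    rewrite addnS psumS; have := q_gt0 (N + M).+1; have := qS (N + M).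
    have : (e (N + M)%N)%:R + 1 <= r%:R :> R by rewrite natr1 ler_nat.
    have : 0 <= (e (N + M)%N)%:R :> R by [].
    by move=> *; split; nra.
  apply/andP; split.
    apply: (cvgr_to_ge cvx); near=> M.
    have NM : (N <= M)%N by near: M; exact: nbhs_infty_ge.
    by rewrite -(subnKC NM); case: (le_psum (M - N)%N).
  apply: (cvgr_to_le cvx); near=> M.
  have NM : (N <= M)%N by near: M; exact: nbhs_infty_ge.
  rewrite -(subnKC NM); case: (le_psum (M - N)%N) => _.
  by have := q_gt0 (N + (M - N)); lra.
apply: (@squeeze_cvgr _ _ _ _ (fun N => x - q N) (fun=> x)).
- by apply: nearW => N; have [_ /andP[]] := dx N; lra.
- rewrite -[X in _ --> X]subr0; apply: cvgB; first exact: cvg_cst.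
  exact: cvg_q.
- exact: cvg_cst.
Unshelve. all: by end_near. Qed.

Lemma digits_cons j e x y : (j < r)%N -> r%:R * x = j%:R + y ->
  digits e y -> digits (fun i => if i is i'.+1 then e i' else j) x.
Proof.
move=> jr xE dy [|N].
  split=> //; rewrite psum0 q0; have [_] := dy 0%N; rewrite psum0 q0 => y01.
  have jr' : j%:R + 1 <= r%:R :> R by rewrite natr1 ler_nat.
  have : 0 <= j%:R :> R by [].
  by move: r_gt0 => *; apply/andP; split; nra.
have [eN /andP[l u]] := dy N; split=> //.
rewrite -(ler_pM2l r_gt0) -[x <= _](ler_pM2l r_gt0) mulrDr psum_cons qS xE.
by apply/andP; split; lra.
Qed.

Lemma digits_itv e x : digits e x -> 0 <= x <= 1.
Proof. by move=> /(_ 0%N)[_]; rewrite psum0 q0 add0r. Qed.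

Lemma digits_uncons e x :
  digits e x -> digits (fun i => e i.+1) (r%:R * x - (e 0%N)%:R).
Proof.
move=> dx N; split; first by have [] := dx N.+1.
have := psum_cons (e 0%N) (fun i => e i.+1) N.
have -> : (fun i => if i is i'.+1 then e i'.+1 else e 0%N) = e.
  by apply/funext => -[].
have [_ /andP[l u]] := dx N.+1.
rewrite -(ler_pM2l r_gt0) in l; rewrite -(ler_pM2l r_gt0) mulrDr qS in u.
by move=> E; rewrite E in l u; apply/andP; split; lra.
Qed.

(** Iterating the step from [x] produces digits and remainders [t N] in [X] with
    [x = psum e N + t N * q N]; since [X] lies in the unit interval, the error is at most [q N]. *)
Lemma digits_coind (D : set nat) (X : set R) : X `<=` [set x | 0 <= x <= 1] ->
  (forall x, X x ->
    exists j y, [/\ (j < r)%N, D j, X y & r%:R * x = j%:R + y]) ->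
  forall x, X x -> exists2 e, digits e x & forall i, D (e i).
Proof.
move=> X01 Xstep x Xx.
(* The pair [(0, 0)] is a default outside [X]; the iteration never reaches it. *)
have /choice[st stP] : forall y, exists jz : nat * R, X y ->
    [/\ (jz.1 < r)%N, D jz.1, X jz.2 & r%:R * y = jz.1%:R + jz.2].
  move=> y.
  have [Xy|nXy] := pselect (X y); last by exists (0%N, 0).
  by have [j [z H]] := Xstep y Xy; exists (j, z).
pose t n := iter n (fun y => (st y).2) x.
have Xt n : X (t n) by elim: n => //= n IH; case: (stP _ IH).
pose e n := (st (t n)).1.
exists e => [N|i]; last by case: (stP _ (Xt i)).
have tE : x = psum e N + t N * q N.
  elim: N => [|N IH]; first by rewrite psum0 q0 /= add0r mulr1.
  have [_ _ _] := stP _ (Xt N); rewrite -/(e N) -[(st (t N)).2]/(t N.+1) => tN.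
  by rewrite IH psumS -(qS N) -addrA -mulrDl mulrA (mulrC (t N)) tN.
split; first by case: (stP _ (Xt N)).
have /andP[t0 t1] := X01 _ (Xt N); have := q_gt0 N.
by rewrite {1 2}tE => *; apply/andP; split; nra.
Qed.

Lemma digits_ex x : 0 <= x <= 1 -> exists e, digits e x.
Proof.
move=> x01; have [] := @digits_coind setT [set y | 0 <= y <= 1] _ _ x x01 => //.
  (* The digit is the integer part of [r * y], except at [y = 1], where that would be [r]: there the
     digit is [r - 1] and the remainder is again 1. *)
  move=> y /= /andP[y0 y1]; have [->|yn1] := eqVneq y 1.
    exists (r - 1)%N, 1; split=> //=; last first.
    - by rewrite mulr1 natr1 subn1 prednK// (leq_trans _ r_ge3).
    - by rewrite lexx ler01.
    - by rewrite subn1 prednK// (leq_trans _ r_ge3).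
  have ry0 : 0 <= r%:R * y by rewrite mulr_ge0// ltW.
  have /andP[l u] := truncn_itv ry0.
  exists (Num.truncn (r%:R * y)), (r%:R * y - (Num.truncn (r%:R * y))%:R).
  split=> //=; last by rewrite addrC subrK.
    rewrite -(ltr_nat R); apply: le_lt_trans l _.
    by rewrite -[ltRHS]mulr1 ltr_pM2l// lt_neqAle yn1.
  by move: u; rewrite -natr1; lra.
by move=> e de _; exists e.
Qed.

(** The word consists of the [N] base r digits of [M], leading zeros included, followed by an
    expansion of [t]. Only the last digit of [M] is recorded, under a condition that is vacuous for
    [N = 0]. *)
Lemma digits_prefix N M (t x : R) : (M < r ^ N)%N -> 0 <= t <= 1 ->
  r%:R ^+ N * x = M%:R + t ->
  exists2 e, digits e x & forall n, N = n.+1 -> e n = (M %% r)%N.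
Proof.
move=> MN t01; elim: N M MN x => [|N IH] M MN x.
  move: MN; rewrite expn0 ltnS leqn0 => /eqP ->.
  rewrite expr0 mul1r add0r => ->.
  by have [e de] := digits_ex t01; exists e.
have r0 : (0 < r)%N by exact: leq_trans r_ge3.
have rN : (0 < r ^ N)%N by rewrite expn_gt0 r0.
(* [j] is the leading digit of [M] written with [N.+1] digits. *)
move=> xE; pose j := (M %/ r ^ N)%N; pose y := r%:R * x - j%:R.
have yE : r%:R * x = j%:R + y by rewrite /y addrC subrK.
have [|e de eN] := IH (M %% r ^ N)%N (ltn_pmod _ rN) y.
  rewrite /y mulrBr mulrA -exprSr xE {1}(divn_eq M (r ^ N)) natrD natrM natrX.
  by rewrite -/j; ring.
have jr : (j < r)%N by rewrite ltn_divLR// -expnS.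
exists (fun i => if i is i'.+1 then e i' else j).
  exact: digits_cons jr yE de.
move=> [|n] [NE]; last by rewrite (eN _ NE) NE modn_dvdm// expnS dvdn_mulr.
by move: MN; rewrite /j NE expn1 expn0 divn1 => Mr; rewrite modn_small.
Qed.

(** A leading digit [r - 1] is impossible for [x >= 0]: the remaining digits would represent
    [x * q p + (r - 1)], which exceeds 1 as [r >= 3]. With leading digit 0, division by [r ^ p]
    brings the number into the unit interval. *)
Lemma is_expansionP (p : nat) (a : int -> nat) (x : R) :
  0 <= x -> is_expansion r p a x <->
  a p%:Z = 0%N /\ digits (fun i => a (p%:Z - 1 - i%:Z)) (x * q p).
Proof.
move=> x0; pose e i := a (p%:Z - 1 - i%:Z).
have sumE N : \sum_(0 <= k < N)
    (a (p%:Z - 1 - k%:Z))%:R * r%:R ^ (p%:Z - 1 - k%:Z) = r%:R ^+ p * psum e N.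
  rewrite mulr_sumr; apply: eq_bigr => i _.
  rewrite mulrCA; congr (_ * _); rewrite -addrA -opprD.
  by rewrite expfzDr// -exprnP -exprnN.
have sE : (fun N => - ((a p)%:R * r%:R ^+ p) + \sum_(0 <= k < N)
      (a (p%:Z - 1 - k%:Z))%:R * r%:R ^ (p%:Z - 1 - k%:Z)) =
    fun N => - ((a p)%:R * r%:R ^+ p) + r%:R ^+ p * psum e N.
  by apply/funext => N; rewrite sumE.
have er : (forall i : int, i < p%:Z -> (a i < r)%N) <-> forall N, (e N < r)%N.
  split=> [H N|H i ip]; first by apply: H; lia.
  have -> : i = p%:Z - 1 - (absz (p%:Z - 1 - i)%R)%:Z by lia.
  exact: H.
split=> [[ap /er er' cvx]|[ap dx]]; last first.
  have er' N : (e N < r)%N by have [] := dx N.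
  split; [by left|exact/er|].
  rewrite sE ap mul0r oppr0.
  have -> : x = 0 + r%:R ^+ p * (x * q p) by rewrite mulrCA pow_qE mulr1 add0r.
  by apply: cvgD; [exact: cvg_cst|apply: cvgMr; apply/digits_cvg].
have {cvx} : psum e @ \oo --> x * q p + (a p%:Z)%:R.
  rewrite sE in cvx.
  rewrite (_ : psum e = fun N => (- ((a p)%:R * r%:R ^+ p) +
      r%:R ^+ p * psum e N) * q p + (a p)%:R).
    by apply: cvgD; [apply: cvgMl|exact: cvg_cst].
  apply/funext => N; have := pow_qE p; set A := _ ^+ p; set B := q p => AB.
  have -> : (- ((a p)%:R * A) + A * psum e N) * B + (a p)%:R =
      A * B * (psum e N - (a p)%:R) + (a p)%:R by ring.
  by rewrite AB mul1r subrK.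
move=> /(digits_cvg _ er') dx.
case: ap => ap; first by split=> //; move: dx; rewrite ap addr0.
have rE : (r - 1)%:R = r%:R - 1 :> R by rewrite natrB// (leq_trans _ r_ge3).
have := digits_itv dx; rewrite ap rE.
by move=> ?; exfalso; have := mulr_ge0 x0 (ltW (q_gt0 p)); move: r_ge3R; lra.
Qed.


(** The integer [i] collects the digits to the left of the position of [u]. The intervals are closed
    because an endpoint has two expansions, one for each adjacent interval. *)
Lemma W_predP (x u w : R) : W_pred r x u w <->
  0 <= x <= 1 /\ exists n d i : nat, [/\ u = r%:R ^- n, (d < r)%N, w = d%:R &
    (r * i + d)%:R * u <= x <= (r * i + d).+1%:R * u].
Proof.
have r0 : (0 < r)%N by exact: leq_trans r_ge3.
have powz_inj : injective (fun n : int => r%:R ^ n : R).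
  by apply: ieexprIz => //; move: r_ge3R; lra.
split=> [[[p [a [i [ax ip uE aw]]]] x01 [n un] [d dr wd]]|].
  split=> //; have /andP[x0 x1] := x01.
  have iE : i = - n%:Z.
    by apply: powz_inj; rewrite /= -uE un exprnN.
  have {aw} aid : a i = d by apply/eqP; rewrite -(eqr_nat R) aw wd.
  have [ap dx] := proj1 (is_expansionP p a x0) ax.
  set e := (fun i => _) in dx.
  exists n, d; move: ip; rewrite iE => ip.
  (* If [p + n = 0], the position is that of the leading digit, which is 0 by [ap]. *)
  have [N0|[N NE]] : (p + n = 0 \/ exists N, p + n = N.+1)%N.
  - by case: (p + n)%N => [|N]; [left|right; exists N].
  - exists 0%N; rewrite un; split=> //.
    have -> : d = 0%N by rewrite -aid iE -ap; congr a; lia.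
    have -> : n = 0%N by lia.
    by rewrite muln0 expr0 invr1 !mulr1.
  have eN : e N = d by rewrite -aid iE /e; congr a; lia.
  have [M ME] := psum_nat e N; exists M; rewrite un; split=> //.
  have [_] := dx N.+1; rewrite (psumS_nat ME) eN.
  have -> : q N.+1 = q n * q p by rewrite -NE /q addnC exprD invfM.
  have := q_gt0 p => qp.
  rewrite -{3}[q n * q p]mul1r -mulrDl natr1 !mulrA ler_pM2r//.
  by rewrite ler_pM2r.
move=> [x01 [n [d [i [-> dr -> /andP[xl xu]]]]]].
split=> //; [|by exists n|by exists d].
have /andP[x0 x1] := x01; set M := (r * i + d)%N in xl xu.
have qn := q_gt0 n.
have MN : (M < r ^ n.+1)%N.
  rewrite -(ltr_nat R) natrX -(ltr_pM2r (q_gt0 n)) exprS -mulrA pow_qE mulr1.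
  by move: r_ge3R; rewrite -/(q n) in xl; lra.
pose t := r%:R ^+ n * x - M%:R.
have t01 : 0 <= t <= 1.
  rewrite -/(q n) -natr1 in xl xu; have pq := pow_qE n.
  have p0 : 0 < r%:R ^+ n :> R by exact: exprn_gt0.
  move: xl xu; rewrite -(ler_pM2l p0) -[x <= _](ler_pM2l p0).
  by rewrite ![_ ^+ _ * (_ * q n)]mulrCA pq /t => *; lra.
(* Dividing [x] by [r] makes the unit position part of the word, so that [n = 0] is covered;
   accordingly the expansion built below has [p = 1] and leading digit 0. *)
have [|e de eN] := @digits_prefix n.+1 M t (x * q 1) MN t01.
  have -> : r%:R ^+ n.+1 * (x * q 1) = r%:R ^+ n * x * (r%:R * q 1).
    by rewrite exprS; ring.
  by rewrite qS q0 mulr1 /t [RHS]addrC subrK.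
exists 1%N, (fun i : int => if i is Negz m then e m.+1 else
  if i == 0 then e 0%N else 0%N), (- n%:Z).
split.
- apply/is_expansionP => //; split => //.
  rewrite (_ : (fun i => _) = e)//; apply/funext => m.
  by rewrite subrr sub0r; case: m.
- by clear; lia.
- by rewrite exprnN.
- have Md : (M %% r)%N = d by rewrite /M mulnC modnMDl modn_small.
  by rewrite -Md -(eN n erefl); clear; case: n.
Qed.

(** * Numbers with an expansion omitting the digits in K *)

Section admissible_expansions.
Variable K : set nat.
Hypothesis hK : K `<=` [set k : nat | (1 <= k <= r - 2)%N].

Let nK0 : ~ K 0%N. Proof. by move=> /hK. Qed.
Let nKr : ~ K (r - 1)%N. Proof. by move=> /hK /=; lia. Qed.

Let C_digits : set R := [set x | exists2 e, digits e x & forall i, ~ K (e i)].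

Let C_digits_fix x : C_digits x <->
  exists j y, [/\ (j < r)%N, ~ K j, C_digits y & r%:R * x = j%:R + y].
Proof.
split=> [[e dx nKe]|[j [y [jr nKj [e dy nKe] xE]]]].
  exists (e 0%N), (r%:R * x - (e 0%N)%:R); split=> //.
  - by have [] := dx 0%N.
  - by exists (fun i => e i.+1) => //; exact: digits_uncons.
  - by rewrite addrC subrK.
exists (fun i => if i is i'.+1 then e i' else j); last by case.
exact: digits_cons jr xE dy.
Qed.

Let C_digits0 : C_digits 0.
Proof.
have [||e de eK] := @digits_coind (~` K) [set 0] _ _ 0 erefl.
- by move=> x /= ->; rewrite lexx ler01.
- move=> x /= ->; exists 0%N, 0; split=> //; first exact: leq_trans r_ge3.
  by rewrite mulr0 addr0.
- by exists e.
Qed.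

Let C_digits1 : C_digits 1.
Proof.
have r0 : (0 < r)%N by exact: leq_trans r_ge3.
have [||e de eK] := @digits_coind (~` K) [set 1] _ _ 1 erefl.
- by move=> x /= ->; rewrite lexx ler01.
- move=> x /= ->; exists (r - 1)%N, 1; split=> //.
    by rewrite subn1 prednK.
  by rewrite mulr1 natr1 subn1 prednK.
- by exists e.
Qed.

(** Digits left of the radix point are removed one at a time. If the first digit of [x * q p.+1] is
    nonzero, then [x * q p], being at most 1, equals 1, and 1 is admissible through the digits
    [r - 1]. *)
Lemma C_predP (x : R) : C_pred r K x <-> C_digits x.
Proof.
split=> [|[e dx nKe]].
  move=> [/andP[x0 x1] [p [a [/(is_expansionP _ _ x0)[ap dx] nKa]]]].
  have : C_digits (x * q p).
    by eexists; [exact: dx|move=> i; apply: nKa; lia].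
  elim: p {ap dx nKa} => [|p IH]; first by rewrite q0 mulr1.
  move=> /C_digits_fix[j [y [jr nKj [e dy nKe]]]]; rewrite mulrCA qS => E.
  have y01 := digits_itv dy.
  have xp0 : 0 <= x * q p by rewrite mulr_ge0// ltW.
  have xp1 : x * q p <= 1 by apply: mulr_ile1 => //; exact: ltW.
  apply: IH; have [j0|j0] := posnP j.
    by rewrite E j0 add0r; exists e.
  have j1 : 1 <= j%:R :> R by rewrite (ler_nat _ 1).
  suff -> : x * q p = 1 by exact: C_digits1.
  by lra.
have x01 := digits_itv dx; split=> //; have /andP[x0 _] := x01.
exists 0%N, (fun i : int => if i is Negz m then e m else 0%N); split.
  apply/is_expansionP => //; split=> //; rewrite q0 mulr1.
  rewrite (_ : (fun i => _) = e)//; apply/funext => m.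
  by rewrite sub0r -opprD -[1 + _]/(Posz m.+1) -NegzE.
by case.
Qed.

Lemma C_pred_fix (x : R) : C_pred r K x <->
  exists j y, [/\ (j < r)%N, ~ K j, C_pred r K y & r%:R * x = j%:R + y].
Proof.
rewrite C_predP C_digits_fix.
by split=> -[j [y [jr nKj /C_predP Cy E]]]; exists j, y.
Qed.

Lemma C_pred0 : C_pred r K (0 : R). Proof. exact/C_predP. Qed.

Lemma C_pred1 : C_pred r K (1 : R). Proof. exact/C_predP. Qed.

(** The expansion is chosen after the position, which makes the condition first-order over
    [W_pred]. *)
Definition digitwise : set R := [set x | 0 <= x <= 1 /\ forall n : nat,
  exists2 d, (d < r)%N & ~ K d /\ W_pred r x (r%:R ^- n) d%:R].

Let digitwiseP x : digitwise x <-> 0 <= x <= 1 /\ forall n,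
  exists d i : nat, [/\ (d < r)%N, ~ K d &
    (r * i + d)%:R <= r%:R ^+ n * x <= (r * i + d).+1%:R].
Proof.
have p0 n : 0 < r%:R ^+ n :> R by exact: exprn_gt0.
have scale n (y z : R) : (y * q n <= z) = (y <= r%:R ^+ n * z).
  by rewrite ler_pdivrMr// mulrC.
have scale' n (y z : R) : (z <= y * q n) = (r%:R ^+ n * z <= y).
  by rewrite ler_pdivlMr// mulrC.
split=> -[x01 H]; split=> // n; have [d] := H n.
  move=> dr [nKd /W_predP[_ [m [d' [i [qE _ dE]]]]]].
  rewrite -/(q n) scale scale' => xE; exists d, i; split=> //.
  by have -> : d = d' by apply/eqP; rewrite -(eqr_nat R) dE.
move=> [i [dr nKd xE]]; exists d => //; split=> //.
by apply/W_predP; split=> //; exists n, d, i; rewrite -/(q n) scale scale'.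
Qed.

(* A real number with two expansions may a priori use a different one at each
   position; peeling off one admissible digit leaves a digitwise admissible
   number, so a single expansion can be built by coinduction. *)
Lemma digitwise_uncons x : digitwise x ->
  exists j y, [/\ (j < r)%N, ~ K j, digitwise y & r%:R * x = j%:R + y].
Proof.
have r0 : (0 < r)%N by exact: leq_trans r_ge3.
have dw0 : digitwise 0.
  apply/digitwiseP; rewrite lexx ler01; split=> // n; exists 0%N, 0%N.
  by rewrite muln0 mulr0 lexx ler01.
have dw1 : digitwise 1.
  apply/digitwiseP; rewrite lexx ler01; split=> // -[|n].
    by exists 0%N, 0%N; rewrite muln0 expr0 mulr1 lexx ler01.
  have rn : (0 < r ^ n)%N by rewrite expn_gt0 r0.
  exists (r - 1)%N, (r ^ n - 1)%N; rewrite mulr1 -natrX !ler_nat.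
  have -> : (r * (r ^ n - 1) + (r - 1)).+1 = (r ^ n.+1)%N by rewrite expnS; nia.
  split=> //; first by rewrite subn1 prednK.
  rewrite leqnn andbT expnS; nia.
move=> /digitwiseP[x01 H]; have [d [m [dr nKd]]] := H 1%N.
rewrite expr1 => /andP[l u].
have [xE|xn1] := eqVneq x 1.
  exists (r - 1)%N, 1; split=> //; first by rewrite subn1 prednK.
  by rewrite xE mulr1 natr1 subn1 prednK.
have {}xn1 : x < 1 by rewrite lt_neqAle xn1; case/andP: x01.
(* As [x < 1], the digits left of position -1 in the chosen expansion all vanish. *)
have m0 : m = 0%N.
  have : (r * m + d < r)%N.
    by rewrite -(ltr_nat R); apply: le_lt_trans l _; rewrite gtr_pMr.
  by case: m {l u} => // m; rewrite mulnS; lia.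
rewrite m0 muln0 add0n in l u.
pose y := r%:R * x - d%:R; exists d, y; split=> //; last by rewrite addrC subrK.
have [->//|yn0] := eqVneq y 0.
have y0 : 0 < y by rewrite lt_neqAle eq_sym yn0 subr_ge0.
have y1 : y <= 1 by move: u; rewrite -natr1 /y; lra.
apply/digitwiseP; split; first by rewrite ltW.
case=> [|n].
  exists 0%N, 0%N; rewrite muln0 expr0 mul1r; split=> //.
  by rewrite ltW.
have [d' [i [dr' nKd' /andP[l' u']]]] := H n.+2.
have E : r%:R ^+ n.+2 * x = (r * (r ^ n * d))%:R + r%:R ^+ n.+1 * y.
  by rewrite /y natrM natrM natrX !exprS; ring.
rewrite E in l' u'.
(* Strict positivity excludes the lower expansion of [d / r], so the prefix [i] of [x] must start
   with the digit [d]; this is why [y = 0] was treated apart. *)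
have py : 0 < r%:R ^+ n.+1 * y by rewrite mulr_gt0// exprn_gt0.
have di : (r ^ n * d <= i)%N.
  have : (r * (r ^ n * d) < (r * i + d').+1)%N by rewrite -(ltr_nat R); lra.
  rewrite ltnS => h; rewrite -ltnS -(ltn_pmul2l r0); apply: leq_ltn_trans h _.
  by rewrite mulnS addnC ltn_add2r.
exists d', (i - r ^ n * d)%N; split=> //.
have iE : (r * i + d' = r * (r ^ n * d) + (r * (i - r ^ n * d) + d'))%N.
  by rewrite addnA -mulnDr subnKC.
by rewrite iE -addnS !natrD in l' u' *; apply/andP; split; lra.
Qed.

Lemma C_pred_digitwise x : C_pred r K x <-> digitwise x.
Proof.
split=> [/C_predP[e dx nKe]|dw]; last first.
  apply/C_predP; have [||e de eK] := @digits_coind (~` K) digitwise _ _ x dw.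
  - by move=> y [].
  - exact: digitwise_uncons.
  - by exists e.
have x01 := digits_itv dx; split=> // -[|n].
  exists 0%N; first exact: leq_trans r_ge3.
  split=> //; apply/W_predP; split=> //; exists 0%N, 0%N, 0%N; split=> //.
    exact: leq_trans r_ge3.
  by rewrite muln0 expr0 invr1 !mulr1.
exists (e n); first by have [] := dx n.
split=> //; apply/W_predP; split=> //; have [M ME] := psum_nat e n.
exists n.+1, (e n), M; split=> //; first by have [] := dx n.
have [_] := dx n.+1.
by rewrite (psumS_nat ME) -[_.+1%:R]natr1 [(_ + 1) * _]mulrDl mul1r.
Qed.

End admissible_expansions.

(** * Gaps of a self-similar set, and the digit run from k to c *)

Section gaps.
Variables (K : set nat) (C : set R).
Hypothesis C_itv : forall x, C x -> 0 <= x <= 1.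
Hypothesis C0 : C 0.
Hypothesis C1 : C 1.
Hypothesis C_fix : forall x, C x <->
  exists j y, [/\ (j < r)%N, ~ K j, C y & r%:R * x = j%:R + y].

Variables k c : nat.
Hypothesis k_gt0 : (0 < k)%N.
Hypothesis K_ltk : forall j, (j < k)%N -> ~ K j.
Hypothesis k_ltc : (k < c)%N.
Hypothesis c_ltr : (c < r)%N.
Hypothesis Kc : ~ K c.
Hypothesis K_run : forall j, (k <= j < c)%N -> K j.

Let k_ge1R : 1 <= k%:R :> R. Proof. by rewrite (ler_nat _ 1). Qed.
Let kc_leR : k%:R + 1 <= c%:R :> R. Proof. by rewrite natr1 ler_nat. Qed.
Let c_leR : c%:R + 1 <= r%:R :> R. Proof. by rewrite natr1 ler_nat. Qed.

Lemma ex_q_lt (e : R) : 0 < e -> exists n, q n < e.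
Proof.
move=> e0; have bern n : 1 + n%:R <= r%:R ^+ n :> R.
  elim: n => [|n IH]; first by rewrite expr0 addr0.
  rewrite -natr1 exprS; have := r_ge3R; have : 0 <= n%:R :> R by [].
  by move: IH; nra.
exists (Num.truncn e^-1).
rewrite /q invf_plt ?posrE ?exprn_gt0//.
apply: lt_le_trans (bern _); rewrite addrC natr1.
by rewrite truncnS_gt.
Qed.

(** The decomposition [r * x = j + y] is unique unless [y] is 0 or 1, and both of these lie in
    [C]. *)
Lemma C_digit j y x : (j < r)%N -> ~ K j -> 0 <= y <= 1 ->
  r%:R * x = j%:R + y -> C x <-> C y.
Proof.
move=> jr nKj y01 xE; split=> [/C_fix[i [z [ir nKi Cz]]]|Cy]; last first.
  by apply/C_fix; exists j, y.
rewrite xE => E; have z01 := C_itv Cz.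
have [ij|ji|ij] := ltngtP i j; last by move: E; rewrite ij => /addrI ->.
  have : i%:R + 1 <= j%:R :> R by rewrite natr1 ler_nat.
  by move=> ?; have -> : y = 0 by lra.
have : j%:R + 1 <= i%:R :> R by rewrite natr1 ler_nat.
by move=> ?; have -> : y = 1 by lra.
Qed.

Definition gap (a b : R) :=
  [/\ a < b, C a, C b & forall z, a < z -> z < b -> ~ C z].

Lemma gap_itv a b : gap a b -> [/\ 0 <= a, a < b & b <= 1].
Proof. by case=> ab /C_itv/andP[a0 _] /C_itv/andP[_ b1] _. Qed.

Lemma gap_lower a b z : gap a b -> C z -> z < b -> z <= a.
Proof.
by move=> [_ _ _ H] Cz zb; rewrite leNgt; apply/negP => az; exact: (H z).
Qed.

Lemma gap_upper a b z : gap a b -> C z -> a < z -> b <= z.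
Proof.
by move=> [_ _ _ H] Cz zb; rewrite leNgt; apply/negP => az; exact: (H z).
Qed.

(** By [C_digit], prepending the admissible digit [j] maps [C] increasingly onto the part of [C]
    between [j / r] and [(j + 1) / r]. *)
Lemma gap_digit j a b a' b' : (j < r)%N -> ~ K j ->
  0 <= a' <= 1 -> 0 <= b' <= 1 ->
  r%:R * a = j%:R + a' -> r%:R * b = j%:R + b' -> gap a b <-> gap a' b'.
Proof.
move=> jr nKj a01 b01 aE bE.
have Ca := C_digit jr nKj a01 aE; have Cb := C_digit jr nKj b01 bE.
have lt (x y x' y' : R) : r%:R * x = j%:R + x' -> r%:R * y = j%:R + y' ->
    (x < y) = (x' < y').
  by move=> xE yE; rewrite -(ltr_pM2l r_gt0) xE yE ltrD2l.
split=> -[ab Cx Cy H]; (split; [| exact/Ca | exact/Cb |]).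
- by rewrite -(lt _ _ _ _ aE bE).
- move=> z' az zb; pose z := (j%:R + z') / r%:R.
  have zE : r%:R * z = j%:R + z' by rewrite mulrC divfK// gt_eqF.
  have z01 : 0 <= z' <= 1 by lra.
  move/(C_digit jr nKj z01 zE); apply: H; first by rewrite (lt _ _ _ _ aE zE).
  by rewrite (lt _ _ _ _ zE bE).
- by rewrite (lt _ _ _ _ aE bE).
- move=> z; set z' := r%:R * z - j%:R.
  have zE : r%:R * z = j%:R + z' by rewrite /z' addrC subrK.
  rewrite (lt _ _ _ _ aE zE) (lt _ _ _ _ zE bE) => az zb.
  have z01 : 0 <= z' <= 1 by lra.
  by move/(C_digit jr nKj z01 zE); exact: H.
Qed.

Lemma C_natdiv j : (j < r)%N -> ~ K j -> C (j%:R / r%:R).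
Proof.
move=> jr nKj; apply/C_fix; exists j, 0; split => //.
by rewrite addr0 mulrC divfK// gt_eqF.
Qed.

Lemma first_gap : gap (k%:R / r%:R) (c%:R / r%:R).
Proof.
have rV (x : R) : r%:R * (x / r%:R) = x by rewrite mulrC divfK// gt_eqF.
split.
- by rewrite ltr_pM2r ?invr_gt0// ltr_nat.
(* The digit [k] is forbidden, so [k / r] is reached as the digit [k - 1] followed by the tail 1. *)
- apply/C_fix; exists k.-1, 1; split => //.
  + by apply: leq_ltn_trans (leq_pred k) (ltn_trans k_ltc c_ltr).
  + by apply: K_ltk; rewrite prednK.
  + by rewrite rV natr1 prednK.
- exact: C_natdiv.
- move=> z; rewrite -(ltr_pM2l r_gt0) rV -[z < _](ltr_pM2l r_gt0) rV.
  move=> kz zc /C_fix[j [y [jr nKj /C_itv y01 E]]]; rewrite E in kz zc.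
  have jc : (j < c)%N by rewrite -(ltr_nat R); lra.
  have jk : (j < k)%N.
    by rewrite ltnNge; apply/negP => kj; apply: nKj; apply: K_run; rewrite kj.
  have : j%:R + 1 <= k%:R :> R by rewrite natr1 ler_nat.
  by lra.
Qed.

(* The real number all of whose base [r] digits are [c], and its truncations. *)
Let xs : R := c%:R / (r - 1)%:R.
Let bs (n : nat) : R := xs * (1 - q n).

Let xsE : (r%:R - 1) * xs = c%:R.
Proof.
have rE : (r - 1)%:R = r%:R - 1 :> R by rewrite natrB// (leq_trans _ r_ge3).
by rewrite /xs rE mulrC divfK//; have := r_ge3R; lra.
Qed.

Let xs_gt0 : 0 < xs. Proof. by move: xsE r_ge3R k_ge1R kc_leR; nra. Qed.
Let xs_le1 : xs <= 1. Proof. by move: xsE r_ge3R c_leR; nra. Qed.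

Let bs0 : bs 0 = 0. Proof. by rewrite /bs q0 subrr mulr0. Qed.

Let bsS n : r%:R * bs n.+1 = c%:R + bs n.
Proof. by rewrite /bs -xsE -(qS n); ring. Qed.

Let bs_itv n : 0 <= bs n <= 1.
Proof.
rewrite /bs; have := q_le1 n; have := q_gt0 n; move: xs_gt0 xs_le1 => *.
by apply/andP; split; nra.
Qed.

Let C_bs n : C (bs n).
Proof.
elim: n => [|n IH]; first by rewrite bs0.
by rewrite (C_digit c_ltr Kc (bs_itv n) (bsS n)).
Qed.

Let as_ n : R := bs n.+1 - (c - k)%:R * q n.+1.

Let ckE : (c - k)%:R = c%:R - k%:R :> R.
Proof. by rewrite natrB// ltnW. Qed.

(** This is the first gap with [n] digits [c] put in front of it. *)
Lemma gap_bs n : gap (as_ n) (bs n.+1).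
Proof.
elim: n => [|n IH].
  have rV (x y : R) : r%:R * x = y -> y / r%:R = x.
    by move=> <-; rewrite mulrC mulKf// gt_eqF.
  have <- : c%:R / r%:R = bs 1 by apply: rV; rewrite bsS bs0 addr0.
  suff <- : k%:R / r%:R = as_ 0 by exact: first_gap.
  apply: rV; rewrite /as_ mulrBr bsS bs0 mulrCA qS q0 ckE; ring.
have [a0 ab b1] := gap_itv IH.
have a01 : 0 <= as_ n <= 1 by lra.
have aE : r%:R * as_ n.+1 = c%:R + as_ n.
  by rewrite /as_ mulrBr bsS mulrCA qS; ring.
exact: (proj2 (gap_digit c_ltr Kc a01 (bs_itv n.+1) aE (bsS _)) IH).
Qed.

(** After removal of [n] digits [c] the gap lies to the left of [k / r]. All digits below [k] are
    admissible, so the multiples of [1 / r] up to [k / r] belong to [C] and bound the length by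
    [1 / r]. *)
Lemma gap_below_as n a b :
  gap a b -> bs n <= a -> b <= as_ n -> b - a <= q n.+1.
Proof.
elim: n a b => [|n IH] a b gab na bn.
  have [a0 ab b1] := gap_itv gab.
  have [_ _ /C_fix[j [y [jr nKj Cy E]]] _] := gab.
  have y01 := C_itv Cy; have q1 : r%:R * q 1 = 1 by rewrite qS.
  have q1E (x : R) : x / r%:R = x * q 1 by rewrite /q expr1.
  have bk : r%:R * b <= k%:R.
    have : r%:R * b <= r%:R * as_ 0 by rewrite ler_pM2l.
    by rewrite /as_ mulrBr bsS bs0 mulrCA qS q0 ckE; lra.
  (* If [y = 0] then [b] is itself [j / r], and the point of [C] to its left is [(j - 1) / r]. *)
  have [y0|y0] := eqVneq y 0.
    rewrite y0 addr0 in E.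
    have j0 : (0 < j)%N by rewrite -(ltr_nat R) -E mulr_gt0//; lra.
    have jk : (j <= k)%N by rewrite -(ler_nat R) -E.
    have Cj : C (j.-1%:R / r%:R).
      by apply: C_natdiv; [exact: leq_ltn_trans (leq_pred j) jr
        |apply: K_ltk; rewrite prednK].
    have jE : j.-1%:R + 1 = j%:R :> R by rewrite natr1 prednK.
    have : j.-1%:R / r%:R <= a.
      apply: gap_lower gab Cj _.
      by rewrite -(ltr_pM2l r_gt0) E mulrC divfK ?gt_eqF//; lra.
    by rewrite q1E; move: E jE q1 r_gt0; nra.
  have : j%:R / r%:R <= a.
    apply: gap_lower gab (C_natdiv jr nKj) _.
    by rewrite -(ltr_pM2l r_gt0) E mulrC divfK ?gt_eqF//; lra.
  by rewrite q1E; move: E q1 r_gt0; nra.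
have [a0 ab b1] := gap_itv gab.
have [g0 g2 g1] := gap_itv (gap_bs n).
pose a' := r%:R * a - c%:R; pose b' := r%:R * b - c%:R.
have aE : r%:R * a = c%:R + a' by rewrite /a' addrC subrK.
have bE : r%:R * b = c%:R + b' by rewrite /b' addrC subrK.
have na' : bs n <= a' by rewrite -(lerD2l c%:R) -bsS -aE ler_pM2l.
have bn' : b' <= as_ n.
  rewrite -(lerD2l c%:R) -bE; apply: le_trans (_ : r%:R * as_ n.+1 <= _).
    by rewrite ler_pM2l.
  by rewrite /as_ mulrBr bsS mulrCA qS addrA.
have ab' : a' < b' by rewrite -(ltrD2l c%:R) -bE -aE ltr_pM2l.
have := bs_itv n; have := bs_itv n.+1 => h1 h2.
have a01 : 0 <= a' <= 1 by lra.
have b01 : 0 <= b' <= 1 by lra.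
have := IH a' b' (proj1 (gap_digit c_ltr Kc a01 b01 aE bE) gab) na' bn'.
by rewrite -(qS n.+1) /a' /b' -(ler_pM2l r_gt0 (b - a)); lra.
Qed.

(** * Defining the powers of 1/r from the lengths of gaps *)

Definition record_end (b : R) := exists a, [/\ gap a b, b <= xs &
  forall a' b', gap a' b' -> b < b' -> b' <= xs -> b' - a' < b - a].

Let xs_bs n : xs - bs n = xs * q n. Proof. by rewrite /bs; ring. Qed.

Let ck_ge1 : 1 <= (c - k)%:R :> R.
Proof. by rewrite ckE; move: kc_leR; lra. Qed.

Lemma record_endP b : record_end b <-> exists n, b = bs n.+1.
Proof.
split=> [[a [gab bx rec]]|[n ->]]; last first.
  exists (as_ n); split.
  - exact: gap_bs.
  - by move: (xs_bs n.+1) (q_gt0 n.+1) xs_gt0; nra.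
  - move=> a' b' gab nb' b'x; rewrite /as_ subKr.
    have na' := gap_lower gab (C_bs n.+1) nb'.
    (* The direct bound [xs * q n.+1] on the length is not strict when [xs = 1] and [c - k = 1];
       cutting at [bs n.+2] makes it strict. *)
    have [b'n|nb] := leP b' (bs n.+2).
      have := xs_bs n.+1; have := xs_bs n.+2.
      move: xs_gt0 xs_le1 ck_ge1 (q_gt0 n.+1) (q_gt0 n.+2); nra.
    have a'n := gap_lower gab (C_bs n.+2) nb.
    have := xs_bs n.+1; have := xs_bs n.+2; move: (qS n.+1).
    move: xs_gt0 xs_le1 ck_ge1 (q_gt0 n.+1) (q_gt0 n.+2) r_ge3R; nra.
have [a0 ab b1] := gap_itv gab.
(* No gap ends at [xs], because the points [bs n] of [C] approach it from the left. *)
have {}bx : b < xs.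
  rewrite lt_neqAle bx andbT; apply/eqP => bxs.
  have [n qn] := @ex_q_lt (xs - a) ltac:(lra).
  have bsn : a < bs n by move: (xs_bs n) xs_le1 (q_gt0 n); nra.
  have := gap_upper gab (C_bs n) bsn; rewrite bxs.
  by move: (xs_bs n) xs_gt0 (q_gt0 n); nra.
have exn : exists n, b <= bs n.
  have [n qn] := @ex_q_lt (xs - b) ltac:(lra).
  by exists n; move: (xs_bs n) xs_le1 (q_gt0 n); nra.
case: (ex_minnP exn) => -[|n] bn nmin; first by move: bn; rewrite bs0; lra.
exists n; apply/eqP; rewrite eq_le bn leNgt; apply/negP => {}bn.
have nb : bs n < b by rewrite ltNge; apply/negP => /nmin; rewrite ltnn.
have na := gap_lower gab (C_bs n) nb.
(* Otherwise the gap lies between [bs n] and [as_ n], hence is no longer than the gap ending at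
   [bs n.+1], which lies between it and [xs]. *)
have ban : b <= as_ n by apply: gap_lower (gap_bs n) _ bn; case: gab.
have := gap_below_as gab na ban.
have bxn : bs n.+1 <= xs by move: (xs_bs n.+1) (q_gt0 n.+1) xs_gt0; nra.
have := rec _ _ (gap_bs n) bn bxn; rewrite /as_ subKr.
by move: ck_ge1 (q_gt0 n.+1); nra.
Qed.

(** A record end [bs n.+1] is at distance [xs * q n.+1] from [xs], and [(r - 1) * xs = c]. The
    factor [r] turns [q n.+1] into [q n], so that the exponent 0 is included. *)
Definition in_powers (u : R) := exists2 b, record_end b &
  (r - 1)%:R * (r%:R * (xs - b)) = c%:R * u.

Lemma in_powersP u : in_powers u <-> exists n : nat, u = r%:R ^- n.
Proof.
have E n : (r - 1)%:R * (r%:R * (xs - bs n.+1)) = c%:R * q n.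
  have -> : (r - 1)%:R = r%:R - 1 :> R by rewrite natrB// (leq_trans _ r_ge3).
  by rewrite xs_bs -(qS n) -xsE; ring.
split=> [[b /record_endP[n ->]]|[n ->]].
  rewrite E => /mulfI cu; exists n; apply/esym/cu.
  by rewrite gt_eqF//; move: kc_leR k_ge1R; lra.
by exists (bs n.+1); [apply/record_endP; exists n|exact: E].
Qed.

(** * Defining the multiples of a power of 1/r, uniformly *)

Definition coarse_end (u f : R) := f = 0 \/ exists2 a, gap a f & u <= f - a.

(** Either [f] is a multiple [j / r], or its gap stays to the right of [j / r], where removing the
    digit [j] multiplies its length by [r]. *)
Lemma coarse_end_grid n f :
  coarse_end (q n) f -> exists i : nat, f = i%:R * q n.
Proof.
case=> [->|[a gaf]]; first by exists 0%N; rewrite mul0r.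
elim: n a f gaf => [|n IH] a f gaf len.
  have [a0 af f1] := gap_itv gaf; exists 1%N.
  by move: len; rewrite q0 => ?; lra.
have [a0 af f1] := gap_itv gaf.
have [_ _ /C_fix[j [y [jr nKj Cy E]]] _] := gaf.
have rn0 : r%:R != 0 :> R by rewrite gt_eqF.
have [y0|y0] := eqVneq y 0.
  exists (j * r ^ n)%N; apply: (mulfI rn0); rewrite E y0 natrM natrX mulrCA qS.
  by rewrite -mulrA pow_qE mulr1 addr0.
have y01 := C_itv Cy.
have ja : j%:R <= r%:R * a.
  have : j%:R / r%:R <= a; last by rewrite ler_pdivrMr// mulrC.
  apply: gap_lower gaf (C_natdiv jr nKj) _.
  by rewrite -(ltr_pM2l r_gt0) E mulrC divfK//; lra.
pose a' := r%:R * a - j%:R.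
have aE : r%:R * a = j%:R + a' by rewrite /a' addrC subrK.
have a'y : a' <= y by rewrite -(lerD2l j%:R) -aE -E ler_pM2l// ltW.
have a01 : 0 <= a' <= 1 by rewrite {1}/a'; lra.
have [i iE] := IH _ _ (proj1 (gap_digit jr nKj a01 y01 aE E) gaf)
  ltac:(rewrite -(qS n) /a' -(ler_pM2l r_gt0 (q n.+1)) in len *; lra).
exists (j * r ^ n + i)%N; apply: (mulfI rn0); rewrite E iE mulrCA qS.
by rewrite natrD mulrDl natrM natrX -mulrA pow_qE mulr1.
Qed.

Lemma coarse_end_cons n f f' d : (d == 0%N) || (d == c) ->
  r%:R * f' = d%:R + f -> coarse_end (q n) f -> coarse_end (q n.+1) f'.
Proof.
have rn0 : r%:R != 0 :> R by rewrite gt_eqF.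
move=> dc E [f0|[a gaf len]].
  case/orP: dc => /eqP dE.
    by left; apply: (mulfI rn0); rewrite E dE f0 mulr0 addr0.
  (* The digit [c] in front of 0 gives the end of the first gap, of length at least [1 / r]. *)
  right; exists (k%:R / r%:R).
    suff -> : f' = c%:R / r%:R by exact: first_gap.
    by apply: (mulfI rn0); rewrite E dE f0 addr0 mulrC divfK.
  rewrite -(ler_pM2l r_gt0) qS mulrBr E dE f0 addr0 [r%:R * _]mulrC divfK//.
  by have := q_le1 n; move: kc_leR; lra.
right; have [a0 af f1] := gap_itv gaf.
exists ((d%:R + a) / r%:R).
  have aE : r%:R * ((d%:R + a) / r%:R) = d%:R + a by rewrite mulrC divfK.
  have nKd : (d < r)%N /\ ~ K d.
    case/orP: dc => /eqP-> //; split; last exact: K_ltk.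
    exact: leq_trans r_ge3.
  by apply/(gap_digit nKd.1 nKd.2 _ _ aE E) => //; lra.
by rewrite -(ler_pM2l r_gt0) qS mulrBr E [r%:R * _]mulrC divfK//; lra.
Qed.

(** Since [N] is a numeral, the recursion unfolds to a formula, the same one for all [u]. *)
Fixpoint coarse_sum (N : nat) (u z : R) : Prop :=
  if N is N'.+1 then
    exists y, coarse_end u y /\ coarse_sum N' u (z - y)
  else z = 0.

Lemma coarse_sum_grid N n z :
  coarse_sum N (q n) z -> exists i : nat, z = i%:R * q n.
Proof.
elim: N z => [|N IH] z /=; first by exists 0%N; rewrite mul0r.
move=> [y [/coarse_end_grid[i iE] /IH[j jE]]]; exists (i + j)%N.
by rewrite natrD mulrDl -iE -jE addrC subrK.
Qed.

Lemma coarse_sum0 N u : coarse_sum N u 0.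
Proof.
elim: N => [//|N IH] /=; exists 0; split; first by left.
by rewrite subr0.
Qed.

(** The digit [c] is prepended to [j] of the summands and the digit 0 to the others. *)
Lemma coarse_sum_cons N n j z z' : (j <= N)%N -> r%:R * z' = c%:R * j%:R + z ->
  coarse_sum N (q n) z -> coarse_sum N (q n.+1) z'.
Proof.
have rn0 : r%:R != 0 :> R by rewrite gt_eqF.
have rV (x : R) : r%:R * (x / r%:R) = x by rewrite mulrC divfK.
elim: N j z z' => [|N IH] j z z' jN E /=.
  by move=> z0; apply: (mulfI rn0); rewrite E z0; case: j jN {E} => // _; ring.
move=> [y [ey sy]]; case: j jN E => [|j] jN E.
  exists (y / r%:R); split.
    by apply: (@coarse_end_cons n y _ 0%N) => //; rewrite rV add0r.
  by apply: (IH 0%N (z - y)) => //; rewrite mulrBr rV E; ring.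
exists ((c%:R + y) / r%:R); split.
  by apply: (@coarse_end_cons n y _ c); rewrite ?eqxx ?orbT// rV.
by apply: (IH j (z - y)) => //; rewrite mulrBr rV E -natr1; ring.
Qed.

(** Each base r digit of [i] is a sum of [r - 1] terms equal to 0 or 1; multiplied by [c], these
    become the digits of the [r - 1] summands. *)
Lemma coarse_sum_mul n i : (i < r ^ n)%N ->
  coarse_sum (r - 1) (q n) (c%:R * i%:R * q n).
Proof.
elim: n i => [|n IH] i.
  rewrite expn0 ltnS leqn0 => /eqP ->; rewrite mulr0 mul0r; exact: coarse_sum0.
move=> ilt; have rn : (0 < r ^ n)%N by rewrite expn_gt0 (leq_trans _ r_ge3).
apply: (@coarse_sum_cons _ n (i %/ r ^ n) _ _ _ _ (IH _ (ltn_pmod i rn))).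
  have r0 : (0 < r)%N by exact: leq_trans r_ge3.
  by rewrite -ltnS subn1 prednK// ltn_divLR// -expnS.
rewrite mulrCA qS {1}(divn_eq i (r ^ n)) natrD natrM natrX.
by rewrite mulrDr mulrDl; congr (_ + _); rewrite -!mulrA pow_qE mulr1.
Qed.

Definition grid (u y : R) :=
  exists2 t, (t < c)%N & coarse_sum (r - 1) u (y - t%:R * u).

Lemma grid_mul n y : grid (q n) y -> exists i : nat, y = i%:R * q n.
Proof.
move=> [t _ /coarse_sum_grid[i iE]]; exists (i + t)%N.
by rewrite natrD mulrDl -iE subrK.
Qed.

Lemma mul_grid n i : (i <= r ^ n)%N -> grid (q n) (i%:R * q n).
Proof.
move=> ile; have c1 : (1 < c)%N by apply: leq_trans k_ltc.
have c0 : (0 < c)%N by exact: ltnW.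
exists (i %% c)%N; first by rewrite ltn_pmod.
suff -> : i%:R * q n - (i %% c)%:R * q n = c%:R * (i %/ c)%:R * q n.
  (* As [c >= 2], the quotient [i %/ c] is below [r ^ n] even for [i = r ^ n]. *)
  apply: coarse_sum_mul; rewrite ltn_divLR//.
  apply: leq_ltn_trans ile _; rewrite ltn_Pmulr// expn_gt0.
  by rewrite (leq_trans _ r_ge3).
by rewrite {1}(divn_eq i c) natrD natrM; ring.
Qed.

Definition has_digit (x u w : R) :=
  [/\ 0 <= x <= 1, in_powers u & exists2 d, (d < r)%N & w = d%:R /\
    exists y, grid u y /\ (r%:R * y + d%:R * u <= x /\
                           x <= r%:R * y + d%:R * u + u)].

Lemma has_digitP x u w : has_digit x u w <->
  0 <= x <= 1 /\ exists n d i : nat, [/\ u = r%:R ^- n, (d < r)%N, w = d%:R &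
    (r * i + d)%:R * u <= x <= (r * i + d).+1%:R * u].
Proof.
have E i d (v : R) : (r * i + d)%:R * v = r%:R * (i%:R * v) + d%:R * v.
  by rewrite natrD natrM mulrDl mulrA.
split=> [[x01 /in_powersP[n ->] [d dr [-> [y [/grid_mul[i ->] xE]]]]]|].
  split => //; exists n, d, i; split=> //.
  by rewrite -natr1 mulrDl mul1r E; case: xE => -> ->.
move=> [x01 [n [d [i [-> dr -> /andP[xl xu]]]]]]; split => //.
  by apply/in_powersP; exists n.
exists d => //; split => //; exists (i%:R * q n); split; last first.
  by rewrite -E; split => //; move: xu; rewrite -natr1 mulrDl mul1r.
apply: mul_grid; rewrite -(ler_nat R) natrX.
rewrite -(ler_pM2r (q_gt0 n)) pow_qE.
have : 0 <= d%:R * q n by rewrite mulr_ge0// ltW.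
have iq : 0 <= i%:R * q n by rewrite mulr_ge0// ltW.
by move: xl; rewrite E -/(q n); move: r_ge3R; nra.
Qed.

(** * Definability of the digit predicate from C *)

Let P : set 'rV[R]_1 := [set v | C (v 0 0)].
Implicit Types f g h : (nat -> R) -> R.

Let def_C f : envfun P f -> envdef P (fun e => C (f e)).
Proof.
move=> df; apply: (envdef_app (A := fun x _ => C x) df).
by apply: envdef_ext (envdef_predv P (fun=> 0%N)) _ => e; rewrite /P /= mxE.
Qed.

(** The number 1 is the largest element of [C], so it needs no parameter. *)
Let def_1 : envfun P (fun=> 1).
Proof.
have d0 := envfun_var P 0.
have dmax : envdef P (fun e => C (e 0%N) /\ forall y, C y -> y <= e 0%N).
  apply: envdef_and; first exact: def_C.
  apply: envdef_all; apply: envdef_imp; first exact: def_C.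
  by apply: envdef_le => //; exact: envfun_var.
apply: envdef_ext dmax _ => e; split=> [[Ce max]|->]; last first.
  by split=> // y /C_itv/andP[].
by apply/eqP; rewrite eq_le max// andbT; have /andP[] := C_itv Ce.
Qed.

Let def_nat n : envfun P (fun=> n%:R).
Proof. by apply: envdef_ext (envfunMn n def_1) _ => e; rewrite mulr1. Qed.

Let def_xs : envfun P (fun=> xs).
Proof.
by apply: envfun_divn (def_nat c); rewrite subn_gt0 (leq_trans _ r_ge3).
Qed.

Let def_gap f g : envfun P f -> envfun P g ->
  envdef P (fun e => gap (f e) (g e)).
Proof.
move=> df dg.
have dgap : envdef P (fun e => (f e < g e /\ C (f e)) /\ (C (g e) /\
    forall z, f e < z -> z < g e -> ~ C z)).
  apply: envdef_and; apply: envdef_and; try exact: def_C.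
    exact: envdef_lt.
  apply: envdef_all; apply: envdef_imp; last apply: envdef_imp.
  - by apply: envdef_lt; [exact: envfun_shift|exact: envfun_var].
  - by apply: envdef_lt; [exact: envfun_var|exact: envfun_shift].
  - by apply: envdef_not; apply: def_C; exact: envfun_var.
by apply: envdef_ext dgap _ => e; split=> [[[? ?] []]|[]].
Qed.

Let def_record f : envfun P f -> envdef P (fun e => record_end (f e)).
Proof.
move=> df; pose v i := envfun_var P i.
have d3 := envfun_shift (envfun_shift (envfun_shift df)).
have drec : envdef P (fun e => exists a, gap a (f e) /\ (f e <= xs /\
    forall a' b', gap a' b' -> f e < b' -> b' <= xs -> b' - a' < f e - a)).
  apply: envdef_ex; apply: envdef_and.
    by apply: def_gap (v 0%N) _; exact: envfun_shift.
  apply: envdef_and; first by apply: envdef_le def_xs; exact: envfun_shift.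
  apply: envdef_all; apply: envdef_all; apply: envdef_imp.
    exact: def_gap (v 1%N) (v 0%N).
  apply: envdef_imp; first exact: envdef_lt d3 (v 0%N).
  apply: envdef_imp; first exact: envdef_le (v 0%N) def_xs.
  apply: envdef_lt; first exact: envfunB (v 0%N) (v 1%N).
  exact: envfunB d3 (v 2%N).
apply: envdef_ext drec _ => e.
by split=> [[a [? [? ?]]]|[a [? ? ?]]]; exists a.
Qed.

Let def_powers f : envfun P f -> envdef P (fun e => in_powers (f e)).
Proof.
move=> df; have dpow : envdef P (fun e => exists b, record_end b /\
    (r - 1)%:R * (r%:R * (xs - b)) = c%:R * f e).
  apply: envdef_ex; apply: envdef_and; first exact: def_record (envfun_var P 0).
  apply: envdef_eq; last by apply: envfunMn; exact: envfun_shift.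
  by do 2 apply: envfunMn; exact: envfunB def_xs (envfun_var P 0).
by apply: envdef_ext dpow _ => e; split=> -[b]; [case|]; exists b.
Qed.

Let def_coarse_end f g : envfun P f -> envfun P g ->
  envdef P (fun e => coarse_end (f e) (g e)).
Proof.
move=> df dg; apply: envdef_or; first exact: envdef_eq dg (envfun0 P).
have dE : envdef P (fun e => exists a, gap a (g e) /\ f e <= g e - a).
  apply: envdef_ex; apply: envdef_and.
    by apply: def_gap (envfun_var P 0) _; exact: envfun_shift.
  apply: envdef_le; first exact: envfun_shift.
  by apply: envfunB (envfun_var P 0); exact: envfun_shift.
by apply: envdef_ext dE _ => e; split=> -[a]; [case|]; exists a.
Qed.

Let def_coarse_sum N f g : envfun P f -> envfun P g ->
  envdef P (fun e => coarse_sum N (f e) (g e)).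
Proof.
elim: N f g => [|N IH] f g df dg /=; first exact: envdef_eq dg (envfun0 P).
apply: envdef_ex; apply: envdef_and.
  by apply: def_coarse_end (envfun_var P 0); exact: envfun_shift.
apply: (IH (fun e => f (fun i => e i.+1))
  (fun e => g (fun i => e i.+1) - e 0%N)); first exact: envfun_shift.
by apply: envfunB (envfun_var P 0); exact: envfun_shift.
Qed.

Let def_grid f g : envfun P f -> envfun P g ->
  envdef P (fun e => grid (f e) (g e)).
Proof.
move=> df dg; apply: envdef_ex_ltn => t; apply: def_coarse_sum => //.
by apply: envfunB => //; exact: envfunMn.
Qed.

Lemma envdef_has_digit f g h : envfun P f -> envfun P g -> envfun P h ->
  envdef P (fun e => has_digit (f e) (g e) (h e)).
Proof.
move=> df dg dh.
have dd : envdef P (fun e => (0 <= f e /\ f e <= 1) /\ (in_powers (g e) /\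
    exists2 d, (d < r)%N & h e = d%:R /\ exists y, grid (g e) y /\
      (r%:R * y + d%:R * g e <= f e /\ f e <= r%:R * y + d%:R * g e + g e))).
  apply: envdef_and.
    by apply: envdef_and; apply: envdef_le => //; exact: envfun0.
  apply: envdef_and; first exact: def_powers.
  apply: envdef_ex_ltn => d; apply: envdef_and; first exact: envdef_eq.
  have df' := envfun_shift df; have dg' := envfun_shift dg.
  have dv := envfun_var P 0.
  have ds := envfunD (envfunMn r dv) (envfunMn d dg').
  apply: envdef_ex; apply: envdef_and; first exact: def_grid.
  apply: envdef_and; apply: envdef_le => //.
  by apply: envfunD.
apply: envdef_ext dd _ => e.
by split=> [[/andP ? []]|[/andP ? ? ?]]; split.
Qed.

End gaps.

End base_r_expansions.

(** * Definability of C from the digit predicate *)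

Section definability_of_C.
Variables (R : realType) (r : nat) (K : set nat).
Hypothesis r_ge3 : (3 <= r)%N.
Hypothesis hK : K `<=` [set k : nat | (1 <= k <= r - 2)%N].

Let P : set 'rV[R]_3 := @W_set R r.
Implicit Types f g h : (nat -> R) -> R.

Let def_W f g h : envfun P f -> envfun P g -> envfun P h ->
  envdef P (fun e => W_pred r (f e) (g e) (h e)).
Proof.
move=> df dg dh.
apply: (envdef_app (A := fun x e => W_pred r x (g e) (h e)) df).
apply: (envdef_app (A := fun y e => W_pred r (e 0%N) y (h (fun i => e i.+1)))
  (envfun_shift dg)).
apply: (envdef_app (A := fun z e => W_pred r (e 1%N) (e 0%N) z)
  (envfun_shift (envfun_shift dh))).
(* The argument named last has index 0, hence the reversal. *)
apply: envdef_ext (envdef_predv P (fun i : 'I_3 => 2 - i)%N) _ => e.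
by rewrite /P /W_set /= !mxE.
Qed.

(** A power of [1 / r] that is also a digit is a positive integer at most 1. This defines 1 without
    parameters. *)
Let W_diag (x : R) : W_pred r x x x <-> x = 1.
Proof.
rewrite W_predP//; split=> [[x01 [n [d [_ [xn _ xd _]]]]]|->].
  have : 0 < x.
    by rewrite xn invr_gt0 exprn_gt0// ltr0n (leq_trans _ r_ge3).
  rewrite xd ltr0n => d0; apply/eqP; rewrite eq_le ler1n d0 andbT -xd.
  by case/andP: x01.
split; first by rewrite ler01 lexx.
exists 0%N, 1%N, 0%N; split=> //; last by rewrite muln0 !mulr1 lexx ler1n.
  by rewrite expr0 invr1.
exact: leq_trans r_ge3.
Qed.

Let def_nat n : envfun P (fun=> n%:R).
Proof.
have d1 : envfun P (fun=> 1).
  have v0 := envfun_var P 0.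
  by apply: envdef_ext (def_W v0 v0 v0) _ => e; exact: W_diag.
by apply: envdef_ext (envfunMn n d1) _ => e; rewrite mulr1.
Qed.

Lemma envdef_C_pred f : envfun P f -> envdef P (fun e => C_pred r K (f e)).
Proof.
move=> df; have df' := envfun_shift df; pose v i := envfun_var P i.
(* The number 0 has a digit at every position, so [exists w, W_pred r 0 u w] says exactly that [u]
   is some [r ^- n]. *)
have dC : envdef P (fun e => (0 <= f e /\ f e <= 1%:R) /\
    forall u, (exists w, W_pred r 0 u w) ->
      exists2 d, (d < r)%N & ~ K d /\ W_pred r (f e) u d%:R).
  apply: envdef_and.
    by apply: envdef_and; apply: envdef_le => //; exact: envfun0.
  apply: envdef_all; apply: envdef_imp.
    by apply: envdef_ex; exact: def_W (envfun0 P) (v 1%N) (v 0%N).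
  apply: envdef_ex_ltn => d; apply: envdef_and; first exact: envdef_cst.
  exact: def_W df' (v 0%N) (def_nat d).
apply: envdef_ext dC _ => e; rewrite C_pred_digitwise//.
have r0 : (0 < r)%N by exact: leq_trans r_ge3.
split=> [[/andP f01 H]|[/andP f01 H]]; split=> //.
  move=> n; apply: H; exists 0; apply/W_predP => //.
  rewrite lexx ler01; split=> //; exists n, 0%N, 0%N; split=> //.
  by rewrite muln0 mul0r mul1r lexx invr_ge0 exprn_ge0.
by move=> u [w /W_predP[//|_ [n [_ [_ [-> _ _ _]]]]]].
Qed.

End definability_of_C.

Theorem theoremA (R : realType) (r : nat) (K : set nat)
    (hr : (3 <= r)%N)
    (hK : K `<=` [set k : nat | (1 <= k <= r - 2)%N])
    (hK0 : K !=set0) :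
  interdefinable (expansion_by (@C_set R r K)) (S_structure R r).
Proof.
move=> n A; split; apply: definable_expansion => s ds.
  apply: envdef_ext (envdef_C_pred hr hK (ds 0)) _ => e.
  by rewrite /C_set /= mxE.
have [k0 Kk0] := hK0.
have exk : exists j, `[< K j >] by exists k0; exact/asboolP.
case: (ex_minnP exk) => k /asboolP Kk kmin.
have nKr : ~ K (r - 1)%N by move=> /hK /=; lia.
have /andP[k_gt0 kr] := hK _ Kk.
(* The digit [r - 1] is never in [K], so [c] exists and is at most [r - 1]. *)
have exc : exists j, (k < j)%N && ~~ `[< K j >].
  by exists (r - 1)%N; apply/andP; split; [lia|exact/asboolPn].
case: (ex_minnP exc) => c /andP[kc /asboolPn nKc] cmin.
have cr : (c < r)%N.
  suff : (c <= r - 1)%N by lia.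
  by apply: cmin; apply/andP; split; [lia|exact/asboolPn].
have Kltk j : (j < k)%N -> ~ K j.
  by move=> jk Kj; have := kmin j (asboolT Kj); lia.
have Krun j : (k <= j < c)%N -> K j.
  rewrite leq_eqVlt => /andP[/predU1P[<-//|kj] jc]; apply: contrapT => nKj.
  by have := cmin j; rewrite kj (asboolF nKj) => /(_ isT); lia.
have C_itv (x : R) : C_pred r K x -> 0 <= x <= 1 by case.
have C0 := C_pred0 R hr hK; have C1 := C_pred1 R hr hK.
have C_fix (x : R) := C_pred_fix hr hK x.
apply: envdef_ext (envdef_has_digit hr C_itv C1 c (ds 0) (ds 1) (ds 2)) _ => e.
rewrite /W_set /= !mxE W_predP//.
exact: (has_digitP hr C_itv C0 C1 C_fix k_gt0 Kltk kc cr nKc Krun).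
Qed.
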